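(* Let $H$ be a real Hilbert space, let $C\subset H$ be a nonempty closed convex set, let $G:H\to H$ be a mapping and let $\gamma>0$. Let $I$ be the identity mapping of $H$ and $P_C$ the nearest point projection of $H$ onto $C$. Assume that the mapping $P_C(I-\gamma G)$, regarded as a self-map of $C$, is an enriched $(k,\theta,L)$-almost contraction on $C$ for some $k\in[0,\infty)$, $\theta\in(0,k+1)$ and $L\geq 0$. Then there exists $\lambda\in(0,1]$ such that, for any $x_0\in C$, the sequence $\{x_n\}$ defined by $$x_{n+1}=(1-\lambda)x_n+\lambda P_C(I-\gamma G)x_n,\quad n\geq 0,$$ converges strongly (in norm) to a solution $x^\ast$ of the variational inequality problem $VIP(G,C)$.
   Context: The variational inequality problem $VIP(G,C)$ is: find $x^\ast\in C$ such that $\langle Gx^\ast,x-x^\ast\rangle\geq 0$ for all $x\in C$. Definition. Let $C$ be a nonempty convex subset of a normed linear space $(X,\|\cdot\|)$, $k\in[0,\infty)$, $\theta\in(0,k+1)$ and $L\geq 0$. A mapping $T:C\rightarrow C$ is called an enriched $(k,\theta,L)$-almost contraction on $C$ if $$\|k(x-y)+Tx-Ty\|\leq \theta \|x-y\|+L\|k(x-y)+Tx-y\|\quad\text{for all } x,y\in C.$$ *)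

(* Defs.v *)
From HB Require Import structures.
From mathcomp Require Import all_boot all_order all_algebra.
From mathcomp Require Import all_classical all_reals all_analysis.

Set Implicit Arguments.
Unset Strict Implicit.
Unset Printing Implicit Defensive.

Import Order.TTheory GRing.Theory Num.Theory.
Import numFieldNormedType.Exports.

Local Open Scope classical_set_scope.
Local Open Scope ring_scope.

(* A real Hilbert space is a complete normed space whose norm comes from an
   inner product; [{dot H for idfun}] is the type of symmetric positive definite
   bilinear forms. *)
HB.mixin Record NormedModule_hasInner (R : realType) H of NormedModule R H := {
  inner : {dot H for idfun : R -> R} ;
  inner_norm : forall x : H, inner x x = `|x| ^+ 2
}.

#[short(type="hilbertType")]
HB.structure Definition Hilbert (R : realType) :=
  {H of NormedModule_hasInner R H & CompleteNormedModule R H}.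

Definition is_nearest_point (R : realType) (X : normedModType R) (C : set X)
    (x p : X) : Prop :=
  C p /\ forall y, C y -> `|x - p| <= `|x - y|.

(* When [C] is nonempty, closed and convex and [X] is a Hilbert space, the
   nearest point exists and is unique; the default value [x] of [xget] is then
   never used. *)
Definition nearest_point_projection (R : realType) (X : normedModType R)
    (C : set X) (x : X) : X :=
  xget x [set p | is_nearest_point C x p].

(* The map [T : C -> C] is a total map on [X] sending [C] to [C]; its values
   outside [C] play no role. *)
Definition enriched_almost_contraction (R : realType) (X : normedModType R)
    (C : set X) (k theta L : R) (T : X -> X) : Prop :=
  [/\ set_fun C C T, 0 <= k, 0 < theta < k + 1, 0 <= L &
      forall x y, C x -> C y ->
        `|k *: (x - y) + T x - T y|
          <= theta * `|x - y| + L * `|k *: (x - y) + T x - y| ].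

Definition vip_solution (R : realType) (H : hilbertType R) (G : H -> H)
    (C : set H) (xs : H) : Prop :=
  C xs /\ forall x, C x -> 0 <= inner (G xs) (x - xs).

(* Main.v *)
(* With [lambda = 1 / (k + 1)] the averaged map [S = (1 - lambda) I + lambda T]
   satisfies [|S x - S y| <= d |x - y| + L |S x - y|] for [d = theta / (k + 1) < 1].
   The second term vanishes at [y = S x], so the steps of the iteration
   [x (n + 1) = S (x n)] decrease geometrically; at [y = p], the limit, it tends
   to [0], so [S p = p]. Then [p = T p] is the nearest point of [C] to
   [p - gamma G p], and the variational characterization of nearest points is
   the variational inequality at [p]. *)
Require Import Defs.
From mathcomp Require Import all_boot all_order all_algebra.
From mathcomp Require Import all_classical all_reals all_analysis.
From mathcomp Require Import ring lra.

Set Implicit Arguments.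
Unset Strict Implicit.
Unset Printing Implicit Defensive.

Import Order.TTheory GRing.Theory Num.Theory.
Import numFieldNormedType.Exports.

Local Open Scope classical_set_scope.
Local Open Scope ring_scope.

Lemma convex_set_comb (R : numDomainType) (M : lmodType R) (C : set M)
    (t : R) (x y : M) :
  @convex_set R M C -> 0 <= t <= 1 -> C x -> C y ->
  C ((1 - t) *: x + t *: y).
Proof.
move=> cC /andP[t0 t1] Cx Cy.
have /set_mem := cC y x (Itv01 t0 t1) (mem_set Cy) (mem_set Cx).
by rewrite addrC.
Qed.

Lemma sqr_normB_scale (R : realType) (H : hilbertType R) (u v : H) (t : R) :
  `|u - t *: v| ^+ 2 = `|u| ^+ 2 - 2 * t * inner u v + t ^+ 2 * `|v| ^+ 2.
Proof.
rewrite -!inner_norm hnormB /= expr0 mul1r.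
rewrite linearZr_LR linearZl_LR linearZr_LR /=.
ring.
Qed.

(** Moving from [p] towards [y] by a fraction [t] stays in [C], so it cannot bring the point closer
    to [z]. Expanding the squared distances and dividing by [t] leaves [2 * a <= t * b], which fails
    for small [t] if [a > 0]. *)
Lemma inner_nearest_point_le0 (R : realType) (H : hilbertType R) (C : set H)
    (z p y : H) :
  @convex_set R H C -> is_nearest_point C z p -> C y ->
  inner (z - p) (y - p) <= 0.
Proof.
move=> cC [Cp pmin] Cy; rewrite leNgt; apply/negP => a_gt0.
set a := inner _ _ in a_gt0; set b := `|y - p| ^+ 2.
have b_ge0 : 0 <= b by rewrite exprn_ge0.
have first_variation t : 0 < t -> t <= 1 -> 2 * a <= t * b.
  move=> t0 t1.
  have t01 : 0 <= t <= 1 by rewrite ltW.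
  have := pmin _ (convex_set_comb cC t01 Cp Cy).
  have -> : z - ((1 - t) *: p + t *: y) = z - p - t *: (y - p).
    rewrite scalerBl scale1r scalerBr !opprD !opprK !addrA.
    by rewrite [RHS]addrAC.
  move=> /(lerXn2r 2%N); rewrite !nnegrE !normr_ge0 => /(_ isT isT).
  rewrite sqr_normB_scale -/a -/b => le_sq.
  by rewrite -(ler_pM2l t0); nra.
have ab_gt0 : 0 < a + b by rewrite ltr_wpDr.
(* This [t] lies in [(0, 1]] even if [b = 0], and clearing the denominator gives
   [2 * a ^+ 2 + a * b <= 0], which is absurd. *)
have := first_variation (a / (a + b)).
rewrite divr_gt0// ler_pdivrMr// mul1r lerDl => /(_ isT b_ge0).
by rewrite mulrAC ler_pdivlMr//; nra.
Qed.

(* Existence of the nearest point is not needed: if there is none, the default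
   value gives [p = z], and [z] is then nearest to itself. *)
Lemma nearest_point_projection_in (R : realType) (X : normedModType R)
    (C : set X) (z p : X) :
  C p -> nearest_point_projection C z = p -> is_nearest_point C z p.
Proof.
rewrite /nearest_point_projection => Cp.
case: xgetP => [q -> qnear <-//|_ zp]; rewrite zp.
by split=> // y _; rewrite subrr normr0.
Qed.

Lemma projection_fixed_vip (R : realType) (H : hilbertType R) (C : set H)
    (G : H -> H) (gamma : R) (p : H) :
  @convex_set R H C -> 0 < gamma -> C p ->
  nearest_point_projection C (p - gamma *: G p) = p ->
  vip_solution G C p.
Proof.
move=> cC g0 Cp /(nearest_point_projection_in Cp) pnear; split=> // y Cy.
have := inner_nearest_point_le0 cC pnear Cy.
rewrite addrAC subrr add0r linearNl linearZl_LR /=.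
by rewrite oppr_le0 pmulr_rge0.
Qed.

(** The sequence is [x 0] plus the series of its increments, which is dominated in norm by a
    geometric series and so converges by completeness. *)
Lemma cvg_geometric_steps (R : realType) (V : completeNormedModType R)
    (x : nat -> V) (d : R) :
  0 <= d < 1 ->
  (forall n, `|x n.+2 - x n.+1| <= d * `|x n.+1 - x n|) ->
  cvgn x.
Proof.
move=> /andP[d0 d1] step.
have xE : x = (fun n => x 0%N + series (telescope x) n).
  by apply/funext => n; rewrite -eq_sum_telescope.
rewrite xE; apply: is_cvgD; first exact: is_cvg_cst.
apply: normed_cvg.
apply: (@series_le_cvg _ _ (geometric `|x 1%N - x 0%N| d)) => //.
- by move=> n; rewrite normr_ge0.
- by move=> n; apply: geometric_ge0.
- elim=> [|n IH] /=; first by rewrite expr0 mulr1.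
  apply: (le_trans (step n)).
  by rewrite exprS mulrCA ler_wpM2l.
- by apply: is_cvg_geometric_series; rewrite ger0_norm.
Qed.

Lemma almost_contraction_iter_cvg (R : realType) (V : completeNormedModType R)
    (C : set V) (S : V -> V) (d L : R) (x : nat -> V) :
  closed C -> 0 <= d < 1 -> set_fun C C S ->
  (forall u v, C u -> C v -> `|S u - S v| <= d * `|u - v| + L * `|S u - v|) ->
  C (x 0%N) -> (forall n, x n.+1 = S (x n)) ->
  exists p, [/\ C p, S p = p & x n @[n --> \oo] --> p].
Proof.
move=> clC d01 SC Sac Cx0 xS.
have Cx n : C (x n) by elim: n => [//|n IH]; rewrite xS; apply: SC.
have xcvg : cvgn x.
  apply: (cvg_geometric_steps d01) => n.
  (* The order of the pair matters: [S (x n) - x n.+1 = 0] removes the [L] term. *)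
  have := Sac _ _ (Cx n) (Cx n.+1).
  by rewrite -!xS subrr normr0 mulr0 addr0 distrC [in leRHS]distrC.
have Cp : C (limn x) by apply: closed_cvg xcvg => //; apply: nearW.
exists (limn x); split=> //.
have xScvg : x n.+1 @[n --> \oo] --> limn x by rewrite cvg_shiftS.
(* Continuity of [S] is replaced by the almost contraction at the pair [x n], [limn x]: it shows
   that [x n.+1] also tends to [S (limn x)]. *)
apply: (@cvg_unique _ _ (x n.+1 @[n --> \oo])) => //=.
apply/subr_cvg0; apply: norm_cvg0.
apply: (@squeeze_cvgr _ _ _ _ (fun=> 0)
  (fun n => d * `|x n - limn x| + L * `|x n.+1 - limn x|)).
- apply: nearW => n; rewrite normr_ge0/= xS.
  exact: Sac.
- exact: cvg_cst.
- rewrite -[0](addr0 0) -[X in _ --> X + _](mulr0 d) -[X in _ --> _ + X](mulr0 L).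
  by apply: cvgD; apply: cvgMl_tmp; apply/norm_cvg0P; apply/subr_cvg0.
Qed.

Theorem theorem9 (R : realType) (H : hilbertType R) (C : set H)
    (C_nonempty : C !=set0) (C_closed : closed C)
    (C_convex : @convex_set R H C)
    (G : H -> H) (gamma : R) (gamma_gt0 : 0 < gamma)
    (T := fun x : H => nearest_point_projection C (x - gamma *: G x))
    (T_eac : exists k theta L : R,
       enriched_almost_contraction C k theta L T) :
  exists lambda : R, 0 < lambda <= 1 /\
    forall x : nat -> H, C (x 0%N) ->
      (forall n : nat, x n.+1 = (1 - lambda) *: x n + lambda *: T (x n)) ->
      exists xs : H, vip_solution G C xs /\ x n @[n --> \oo] --> xs.
Proof.
have [k [theta [L [TC k0 /andP[theta0 theta_lt] L0 Tac]]]] := T_eac.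
have k1_gt0 : 0 < k + 1 by rewrite ltr_wpDl.
have k1_neq0 : k + 1 != 0 by rewrite gt_eqF.
pose lambda := (k + 1)^-1.
have lambda_gt0 : 0 < lambda by rewrite invr_gt0.
have lambda_le1 : lambda <= 1 by rewrite invf_le1// lerDr.
have lambda01 : 0 <= lambda <= 1 by rewrite ltW.
exists lambda; split=> [|x Cx0 xE]; first by rewrite lambda_gt0.
pose S u := (1 - lambda) *: u + lambda *: T u.
(* Here [1 - lambda = lambda * k], so scaling the enriched inequality by [lambda] turns it into one
   about [S]. *)
have SE u : S u = lambda *: (k *: u + T u).
  by rewrite /S scalerDr scalerA; congr (_ *: _ + _); rewrite /lambda; field.
have SC : set_fun C C S.
  by move=> u Cu; apply: convex_set_comb => //; exact: TC.
have Sac u v : C u -> C v ->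
    `|S u - S v| <= theta * lambda * `|u - v| + L * `|S u - v|.
  move=> Cu Cv.
  have -> : S u - S v = lambda *: (k *: (u - v) + T u - T v).
    rewrite !SE -scalerBr [k *: (_ - _)]scalerBr opprD !addrA.
    by congr (_ *: (_ - _)); rewrite addrAC.
  have Suv : S u - v = lambda *: (k *: (u - v) + T u - v).
    (* Since [lambda * (k + 1) = 1], [v] absorbs the factor [lambda]; thus [theta] gets scaled while
       [L] stays the same. *)
    have {1}-> : v = lambda *: (k *: v + v).
      by rewrite -{3}[v]scale1r -scalerDl scalerA mulVf// scale1r.
    rewrite SE -scalerBr [k *: (_ - _)]scalerBr opprD !addrA.
    by congr (_ *: (_ - _)); rewrite addrAC.
  rewrite Suv !normrZ gtr0_norm//.
  have := Tac _ _ Cu Cv; rewrite -(ler_pM2l lambda_gt0) => /le_trans; apply.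
  by rewrite mulrDr mulrA [lambda * theta]mulrC mulrCA.
have d01 : 0 <= theta * lambda < 1.
  by rewrite mulr_ge0 ?(ltW theta0) ?(ltW lambda_gt0)//= ltr_pdivrMr// mul1r.
have [p [Cp Sp xp]] := almost_contraction_iter_cvg C_closed d01 SC Sac Cx0 xE.
exists p; split=> //; apply: (projection_fixed_vip C_convex gamma_gt0) => //.
(* Cancelling [(1 - lambda) *: p] and then [lambda] in [S p = p] leaves [T p = p]. *)
apply: (scalerI (lt0r_neq0 lambda_gt0)); rewrite -/(T p).
by apply: (addrI ((1 - lambda) *: p)); rewrite -/(S p) Sp -scalerDl subrK scale1r.
Qed.
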